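(* For every integer $k \geq 2$ there exists an integer $n_0$ such that for every odd integer $n \geq n_0$ there exists an $n$-vertex graph $G$ with $\alpha(G) = k$ which admits $\alpha(G)$ pairwise disjoint connected dominating sets but satisfies $\mathcal{C}_n(G) \neq \mathcal{C}(G)$.
   Context: Graphs are finite and simple. $\alpha(G)$ is the independence number of $G$. A connected dominating set (CDS) in a graph $G$ is a set $S \subseteq V(G)$ such that the induced subgraph $G[S]$ is connected and for every vertex $v \in V(G) \setminus S$ there exists a vertex $u \in S$ such that $uv \in E(G)$. The cycle space $\mathcal{C}(G)$ is the vector space over $\mathbb{F}_2$ spanned by the incidence vectors (in $\mathbb{F}_2^{E(G)}$) of the edge-sets of all cycles of $G$. If $G$ has $n$ vertices, $\mathcal{C}_n(G)$ is the subspace of $\mathcal{C}(G)$ spanned by the incidence vectors of the edge-sets of cycles of length $n$ in $G$, i.e. of Hamilton cycles of $G$. *)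

(* Defs.v *)
From HB Require Import structures.
From mathcomp Require Import all_boot all_order all_algebra.

Set Implicit Arguments.
Unset Strict Implicit.
Unset Printing Implicit Defensive.

Import GRing.Theory.
Local Open Scope ring_scope.

Record sgraph (V : finType) := SGraph {
  adj :> rel V;
  adj_sym : symmetric adj;
  adj_irr : irreflexive adj
}.

Section Graph.
Variables (V : finType) (G : sgraph V).

Definition edges : {set {set V}} :=
  [set [set p.1; p.2] | p : V * V & G p.1 p.2].

Definition edge : finType := {e : {set V} | e \in edges}.

Definition independent (S : {set V}) : bool :=
  [forall x in S, forall y in S, ~~ G x y].

Definition alpha : nat := \max_(S : {set V} | independent S) #|S|.

Definition induced (S : {set V}) : rel V :=
  [rel x y | [&& x \in S, y \in S & G x y]].

(* The empty graph is not connected. *)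
Definition connected_in (S : {set V}) : bool :=
  (S != set0) && [forall x in S, forall y in S, connect (induced S) x y].

Definition dominating (S : {set V}) : bool :=
  [forall v in ~: S, exists u in S, G u v].

Definition cds (S : {set V}) : bool := connected_in S && dominating S.

(* A cycle is given by the cyclic list of its (distinct) vertices. *)
Definition is_cycle (c : seq V) : bool := (2 < size c)%N && ucycleb G c.

Definition cycle_edges (c : seq V) : {set {set V}} :=
  [set [set x; next c x] | x in c].

(* ^o is needed for the vector space structure over 'F_2. *)
Definition edge_space : vectType 'F_2 := {ffun edge -> ('F_2)^o}.

Definition incidence (F : {set {set V}}) : edge_space :=
  [ffun e : edge => (val e \in F)%:R : ('F_2)^o].

(* Since the vertices of a cycle are distinct, lists of length at most #|V|
   account for all cycles. *)
Definition cycle_space : {vspace edge_space} :=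
  <<[seq incidence (cycle_edges c) | c : #|V|.-bseq V in
       [pred c : #|V|.-bseq V | is_cycle c]]>>%VS.

Definition cycle_space_of_length (l : nat) : {vspace edge_space} :=
  <<[seq incidence (cycle_edges c) | c : #|V|.-bseq V in
       [pred c : #|V|.-bseq V | is_cycle c & size c == l]]>>%VS.

End Graph.

(* Main.v *)
Require Import Defs.
From mathcomp Require Import all_boot all_order all_algebra.

(** The graphs are joins of a complete graph on [k] hubs with a disjoint union
    of [k] cliques.  An independent set is a single hub or meets each clique at
    most once, so the independence number is [k]; every hub is adjacent to all
    other vertices, so the [k] singletons of hubs are disjoint connected
    dominating sets.

    Deleting the [k] hubs leaves [k] components, and a Hamilton cycle has to
    leave each component through a hub of its own.  This uses up all hubs, so
    no hub is preceded by a hub on the cycle: an edge between two hubs lies on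
    no Hamilton cycle ([hamilton_cycle_leaves_tight_cut]).  Hence the coordinate
    of such an edge vanishes on the span of the Hamilton cycles, whereas a
    triangle through it has coordinate 1
    ([cycle_space_of_length_neq]).  Such a triangle exists because [k >= 2], and
    the cliques can be filled up to [n] vertices as soon as [n >= 2 * k]. *)

Set Implicit Arguments.
Unset Strict Implicit.
Unset Printing Implicit Defensive.

Import GRing.Theory.

Section CyclesAndCuts.
Variables (V : finType) (G : sgraph V).

(** Evaluation at the coordinate [e] is a linear form that kills every
    generator of the first space but not the generator [c] of the second. *)
Lemma cycle_space_of_length_neq (l : nat) (e : {set V}) (c : seq V) :
    e \in edges G ->
    (forall d, is_cycle G d -> size d = l -> e \notin cycle_edges d) ->
    is_cycle G c -> e \in cycle_edges c ->
  cycle_space_of_length G l <> cycle_space G.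
Proof.
move=> eG no_e cycc ec eqC.
pose e' : edge G := Sub e eG.
have szc : size c <= #|V|.
  by case/andP: (cycc) => _ /andP[_ /card_uniqP <-]; apply: max_card.
have : incidence G (cycle_edges c) \in cycle_space G.
  apply/memv_span/imageP; exists (Bseq szc) => //.
rewrite -eqC => /coord_span /(congr1 (fun v : edge_space G => v e')).
rewrite sum_ffunE ffunE ec big1 => [/eqP|i _]; first by rewrite oner_eq0.
rewrite ffunE.
set gens := (X in nth _ X i); have lt_i : i < size gens by rewrite size_image.
have /imageP[d /andP[cycd /eqP szd] ->] := mem_nth 0%R lt_i.
by rewrite ffunE (negbTE (no_e d cycd szd)) scaler0.
Qed.

(** The colour classes outside [S] are unions of components of [G - S].  Each
    class contains a vertex whose successor on the cycle lies in [S]; these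
    successors are distinct and at least [#|S|] in number, so they are all of
    [S], and no vertex of [S] can have a predecessor in [S]. *)
Lemma hamilton_cycle_leaves_tight_cut (T : finType) (col : V -> T)
    (S : {set V}) (c : seq V) (s : V) :
    (forall x y, x \notin S -> y \notin S -> G x y -> col x = col y) ->
    #|S| <= #|[set col x | x in ~: S]| ->
    is_cycle G c -> size c = #|V| ->
  s \in S -> next c s \notin S.
Proof.
move=> colG leS /andP[_ /andP[Gc Uc]] szc sS; apply/negP => nsS.
have cT x : x \in c.
  by have [_ ->] := uniq_min_size Uc (fun y _ => mem_enum V y)
     (eq_leq (esym (etrans szc (cardE V)))); rewrite mem_enum.
pose X := [set x in ~: S | next c x \in S].
have next_inj : injective (next c) := can_inj (prev_next Uc).
have leX : #|[set col x | x in ~: S]| <= #|X|.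
  apply: leq_trans (leq_imset_card col X); apply: subset_leq_card.
  apply/subsetP => t /imsetP[x xS ->{t}].
  (* Otherwise the cycle would never leave the colour class of [x]. *)
  apply/negPn/negP => noX.
  have stay : fclosed (next c) [pred y | (y \notin S) && (col y == col x)].
    apply: (intro_closed (fconnect_sym next_inj)) => y _ /eqP <-.
    rewrite !inE => /andP[yS /eqP yx].
    have nyS : next c y \notin S.
      apply: contra noX => nyS; apply/imsetP; exists y => //.
      by rewrite !inE yS nyS.
    by rewrite nyS -yx eq_sym (colG y (next c y)) ?eqxx ?(next_cycle Gc).
  have xs : fconnect (next c) x s.
    by rewrite (fconnect_cycle (cycle_next Uc) (cT x)) cT.
  have := closed_connect stay xs.
  by rewrite !inE sS eqxx andbT; move: xS; rewrite inE => ->.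
have eqS : next c @: X = S.
  apply/eqP; rewrite eqEcard card_imset // (leq_trans leS leX) andbT.
  by apply/subsetP => y /imsetP[x]; rewrite !inE => /andP[_ ?] ->.
move: nsS; rewrite -{1}eqS => /imsetP[x xX /next_inj sx].
by move: xX; rewrite -sx !inE sS.
Qed.

End CyclesAndCuts.

Section CliqueJoin.
Variables (H A I : finType) (col : A -> I).

(** This is the join of the complete graph on [H] with the disjoint union of
    the complete graphs on the fibres of [col]. *)
Definition clique_join_adj : rel (H + A) := fun x y =>
  (x != y) && if (x, y) is (inr a, inr b) then col a == col b else true.

Lemma clique_join_adj_sym : symmetric clique_join_adj.
Proof.
by move=> [x|x] [y|y]; rewrite /clique_join_adj eq_sym //= [col x == _]eq_sym.
Qed.

Lemma clique_join_adj_irr : irreflexive clique_join_adj.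
Proof. by move=> x; rewrite /clique_join_adj eqxx. Qed.

Definition clique_join : sgraph (H + A)%type :=
  SGraph clique_join_adj_sym clique_join_adj_irr.

Definition hubs : {set H + A} := [set inl h | h : H].

Lemma mem_hubs (x : H + A) : (x \in hubs) = if x is inl _ then true else false.
Proof.
by case: x => x; [rewrite imset_f | apply/negbTE/imsetP => -[]].
Qed.

Lemma card_hubs : #|hubs| = #|H|.
Proof. by rewrite card_imset // => x y []. Qed.

Lemma hub_adj (h : H) (x : H + A) : inl h != x -> clique_join (inl h) x.
Proof. by move=> hx; rewrite /= /clique_join_adj hx; case: x {hx}. Qed.

Hypotheses (I_gt0 : 0 < #|I|) (col_surj : forall i, exists a, col a = i).

Lemma alpha_clique_join : alpha clique_join = #|I|.
Proof.
apply/eqP; rewrite eqn_leq; apply/andP; split.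
  apply/bigmax_leqP => S indS.
  have indE x y : x \in S -> y \in S -> ~~ clique_join x y.
    by move=> xS yS; move/forall_inP/(_ x xS)/forall_inP: indS; apply.
  have [/existsP[h hS]|noH] := boolP [exists h, inl h \in S].
    apply: leq_trans I_gt0; rewrite -(cards1 (inl h : H + A)).
    apply/subset_leq_card/subsetP => x xS; rewrite inE eq_sym.
    by apply: contraNT (indE _ _ hS xS); apply: hub_adj.
  pose f (x : H + A) := if x is inr a then Some (col a) else None.
  have f_inj : {in S &, injective f}.
    move=> [h|a] [h'|b] xS yS //=; last 1 first.
    - move=> [eq_ab]; apply/eqP; apply: contraNT (indE _ _ xS yS) => ab.
      by rewrite /= /clique_join_adj ab eq_ab eqxx.
    - by case/existsP: noH; exists h.
  rewrite -(card_in_imset f_inj) -(card_imset I (@Some_inj _)).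
  apply/subset_leq_card/subsetP => _ /imsetP[[h|a] xS ->] /=.
    by case/existsP: noH; exists h.
  exact: imset_f.
(* Conversely, one vertex from each clique gives an independent set. *)
have colP i : exists a, col a == i by have [a <-] := col_surj i; exists a.
pose r i : H + A := inr (xchoose (colP i)).
have rK i j : col (xchoose (colP i)) = col (xchoose (colP j)) -> i = j.
  by rewrite (eqP (xchooseP (colP i))) (eqP (xchooseP (colP j))).
have r_inj : injective r by move=> i j [] /(congr1 col) /rK.
rewrite -(card_imset I r_inj) /alpha.
apply: (@leq_bigmax_cond _ _ (fun S : {set H + A} => #|S|)).
apply/forall_inP => _ /imsetP[i _ ->]; apply/forall_inP => _ /imsetP[j _ ->].
rewrite /= /clique_join_adj; apply/negP => /andP[ij /eqP /rK eq_ij].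
by rewrite eq_ij eqxx in ij.
Qed.

Lemma cds_hub (h : H) : cds clique_join [set inl h].
Proof.
apply/andP; split; first (apply/andP; split).
- by apply/set0Pn; exists (inl h); rewrite inE.
- apply/forall_inP => x /set1P ->; apply/forall_inP => y /set1P ->.
  exact: connect0.
- apply/forall_inP => x; rewrite !inE => xh.
  by apply/exists_inP; exists (inl h); rewrite ?inE // hub_adj // eq_sym.
Qed.

Lemma disjoint_cds_clique_join :
  exists P : {set {set H + A}},
    [/\ #|P| = #|H|, trivIset P & forall S, S \in P -> cds clique_join S].
Proof.
exists [set [set x] | x in hubs]; split.
- by rewrite card_imset ?card_hubs //; apply: set1_inj.
- apply/trivIsetP => _ _ /imsetP[x _ ->] /imsetP[y _ ->] xy.
  rewrite disjoints1 inE; apply: contraNneq xy => ->; exact: eqxx.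
- move=> _ /imsetP[_ /imsetP[h _ ->] ->]; exact: cds_hub.
Qed.

(** The hubs form a cut that leaves [#|I|] components, one per colour, so they
    are tight as soon as they are no more numerous than the colours. *)
Lemma hub_edge_notin_hamilton_cycle (x y : H + A) (c : seq (H + A)) :
    #|H| <= #|I| -> x \in hubs -> y \in hubs ->
    is_cycle clique_join c -> size c = #|{: H + A}| ->
  [set x; y] \notin cycle_edges c.
Proof.
move=> leHI xH yH cycc szc.
have xyH : [set x; y] \subset hubs by rewrite subUset !sub1set xH.
apply/negP => /imsetP[z _ zE]; move: xyH; rewrite zE subUset !sub1set.
case/andP => zH; apply/negP.
pose f (v : H + A) := if v is inr a then Some (col a) else None.
apply: (hamilton_cycle_leaves_tight_cut (col := f) _ _ cycc szc zH).
- move=> [u|u] [v|v]; rewrite !mem_hubs //= => _ _ /andP[_ /eqP ->] //.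
- rewrite card_hubs (leq_trans leHI) // -(card_imset I (@Some_inj _)).
  apply/subset_leq_card/subsetP => _ /imsetP[i _ ->].
  have [a <-] := col_surj i; apply/imsetP; exists (inr a) => //.
  by rewrite inE mem_hubs.
Qed.

Lemma cycle_space_clique_join :
    1 < #|H| <= #|I| ->
  cycle_space_of_length clique_join #|{: H + A}| <> cycle_space clique_join.
Proof.
case/andP => /card_gt1P[g [h [_ _ gh]]] leHI.
have /card_gt0P[i _] := I_gt0; have [a _] := col_surj i.
pose c : seq (H + A) := [:: inl g; inl h; inr a].
apply: (@cycle_space_of_length_neq _ _ _ [set inl g; inl h] c).
- by apply/imsetP; exists (inl g, inl h); rewrite ?inE //; apply: hub_adj.
- by move=> d; apply: hub_edge_notin_hamilton_cycle; rewrite ?mem_hubs.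
- have ne_gh : inl g != inl h :> H + A by [].
  by rewrite /is_cycle /ucycleb /= /clique_join_adj !inE !negb_or !ne_gh.
- by apply/imsetP; exists (inl g); rewrite ?inE /= ?eqxx.
Qed.

End CliqueJoin.

Theorem proposition1p7 (k : nat) (hk : (2 <= k)%N) :
  exists n0 : nat, forall n : nat, (n0 <= n)%N -> odd n ->
  exists (V : finType) (G : sgraph V),
    [/\ #|V| = n,
        alpha G = k,
        exists P : {set {set V}},
          [/\ #|P| = alpha G, trivIset P & forall S, S \in P -> cds G S]
      & cycle_space_of_length G n <> cycle_space G].
Proof.
have k_gt0 : 0 < k by apply: ltnW.
exists (k + k) => n le2kn _.
(* The cliques are the residue classes modulo [k] among [n - k >= k] vertices. *)
have le_k : k <= n - k by rewrite leq_subRL // (leq_trans (leq_addr k k)).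
pose col (j : 'I_(n - k)) : 'I_k := Ordinal (ltn_pmod j k_gt0).
have col_surj i : exists a, col a = i.
  by exists (widen_ord le_k i); apply: val_inj; rewrite /= modn_small.
have I_gt0 : 0 < #|'I_k| by rewrite card_ord.
have cardV : #|{: 'I_k + 'I_(n - k)}| = n.
  by rewrite card_sum !card_ord subnKC // (leq_trans (leq_addr k k)).
have alphaG := alpha_clique_join 'I_k I_gt0 col_surj.
exists ('I_k + 'I_(n - k))%type, (clique_join 'I_k col).
split=> //; first by rewrite alphaG card_ord.
- by rewrite alphaG; apply: disjoint_cds_clique_join.
- have := cycle_space_clique_join (H := 'I_k) I_gt0 col_surj.
  by rewrite cardV !card_ord hk leqnn; apply.
Qed.
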